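(* Let $I_i=I\cap K[X\setminus\{x_i\}]$ for $i=1,\ldots,n$. If $I$ is unmixed and $Q(A)$ is integral, then $\mathrm{gr}_I(R)$ is reduced if and only if $I_i$ is normal for $i=1,\ldots,n$.
   Context: Let $R=K[x_1,\ldots,x_n]$ be a polynomial ring over a field $K$, $X=\{x_1,\ldots,x_n\}$, and let $I\subset R$ be an ideal of height $g\ge 2$ minimally generated by a finite set $F=\{x^{v_1},\ldots,x^{v_q}\}$ of square-free monomials, all of the same degree $d\ge 2$ (where $x^a=x_1^{a_1}\cdots x_n^{a_n}$). Each variable $x_i$ divides at least one monomial of $F$. $\mathcal C$ is the clutter with vertex set $X$ whose edges are the supports $\mathrm{supp}(x^{v_k})$ (sets of variables dividing $x^{v_k}$), $k=1,\ldots,q$. Let $A$ be the $n\times q$ matrix with column vectors $v_1,\ldots,v_q$. The set covering polyhedron is $Q(A)=\{x\in\mathbb R^n\mid x\ge 0,\ xA\ge\mathbf 1\}$, $\mathbf 1=(1,\ldots,1)$; it is integral if all its vertices have integral entries. A vertex cover of $\mathcal C$ is a subset of $X$ meeting every edge; it is minimal if no proper subset is a vertex cover. $I$ is unmixed if all minimal vertex covers of $\mathcal C$ have the same cardinality. $I_i$ is an ideal of the polynomial ring $K[X\setminus\{x_i\}]$. An ideal $J$ is normal if $J^k=\overline{J^k}$ (integral closure) for all $k\ge 1$. $\mathrm{gr}_I(R)=R/I\oplus I/I^2\oplus I^2/I^3\oplus\cdots$ is the associated graded ring of $I$. A ring is reduced if $0$ is its only nilpotent element. *)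

(* Defs.v *)
From HB Require Import structures.
From mathcomp Require Import all_boot all_order all_algebra.
From mathcomp Require Import generic_quotient ring_quotient.
From mathcomp Require Import mpoly.
From mathcomp Require Import boolp classical_sets reals.

Set Implicit Arguments.
Unset Strict Implicit.
Unset Printing Implicit Defensive.

Import Order.TTheory GRing.Theory Num.Theory.
Local Open Scope classical_set_scope.
Local Open Scope ring_scope.
Local Open Scope quotient_scope.

Section Ideals.
Variable S : comNzRingType.
Implicit Types (G I J P : set S) (k h g : nat).

Definition is_ideal J :=
  [/\ J 0, forall a b, J a -> J b -> J (a + b) & forall a b, J b -> J (a * b)].

Definition ideal_gen G : set S :=
  [set p | exists s : seq (S * S),
     (forall x, x \in s -> G x.2) /\ p = \sum_(x <- s) x.1 * x.2].

Definition minimally_generates G I :=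
  I = ideal_gen G /\ forall G', G' `<` G -> ideal_gen G' <> I.

(* For [k = 0] the empty product generates the unit ideal. *)
Definition ideal_exp I k : set S :=
  ideal_gen [set p | exists f : 'I_k -> S,
                       (forall i, I (f i)) /\ p = \prod_(i < k) f i].

Definition integral_closure J : set S :=
  [set z | exists m (a : nat -> S),
     [/\ (0 < m)%N,
         forall i, (1 <= i <= m)%N -> ideal_exp J i (a i) &
         z ^+ m + \sum_(1 <= i < m.+1) a i * z ^+ (m - i) = 0]].

Definition is_normal J :=
  forall k, (1 <= k)%N -> ideal_exp J k = integral_closure (ideal_exp J k).

Definition is_prime_ideal P :=
  [/\ is_ideal P, ~ P 1 & forall a b, P (a * b) -> P a \/ P b].

(* There is a chain of prime ideals [c 0 < c 1 < ... < c h = P]; the values of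
   [c] beyond [h] are irrelevant. *)
Definition prime_height_ge P h :=
  exists c : nat -> set S,
    [/\ forall i, (i <= h)%N -> is_prime_ideal (c i),
        forall i, (i < h)%N -> c i `<` c i.+1 &
        c h = P].

(* [g] is the minimum of the heights of the primes containing [I]. *)
Definition has_height I g :=
  (forall P, is_prime_ideal P -> I `<=` P -> prime_height_ge P g) /\
  (exists P, [/\ is_prime_ideal P, I `<=` P & ~ prime_height_ge P g.+1]).

Lemma ideal_gen_ideal G : is_ideal (ideal_gen G).
Proof.
split=> [|a b [s [sG ->]] [t [tG ->]]|a b [s [sG ->]]].
- by exists [::]; rewrite big_nil.
- exists (s ++ t); rewrite big_cat; split=> // x.
  by rewrite mem_cat => /orP[/sG|/tG].
- exists [seq (a * x.1, x.2) | x <- s]; split.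
    by move=> _ /mapP[x /sG xG ->].
  by rewrite big_map mulr_sumr; apply: eq_bigr => x _; rewrite mulrA.
Qed.

Lemma ideal_exp0 I k : ideal_exp I k 0.
Proof. by have [] := ideal_gen_ideal [set p | exists f : 'I_k -> S,
  (forall i, I (f i)) /\ p = \prod_(i < k) f i]. Qed.

Lemma ideal_expD I k a b :
  ideal_exp I k a -> ideal_exp I k b -> ideal_exp I k (a + b).
Proof. by have [_ + _] := ideal_gen_ideal [set p | exists f : 'I_k -> S,
  (forall i, I (f i)) /\ p = \prod_(i < k) f i]; apply. Qed.

Lemma ideal_expMl I k a b : ideal_exp I k b -> ideal_exp I k (a * b).
Proof. by have [_ _] := ideal_gen_ideal [set p | exists f : 'I_k -> S,
  (forall i, I (f i)) /\ p = \prod_(i < k) f i]; apply. Qed.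

Lemma ideal_expN I k a : ideal_exp I k a -> ideal_exp I k (- a).
Proof. by rewrite -mulN1r; apply: ideal_expMl. Qed.

Lemma ideal_exp_sum I k (T : Type) (r : seq T) (Q : pred T) (F : T -> S) :
  (forall i, Q i -> ideal_exp I k (F i)) ->
  ideal_exp I k (\sum_(i <- r | Q i) F i).
Proof.
by move=> FI; apply: big_ind => //; [apply: ideal_exp0|apply: ideal_expD].
Qed.

Lemma ideal_exp_unit I a : ideal_exp I 0 a.
Proof.
exists [:: (a, 1)]; split=> [x|]; last by rewrite big_seq1 mulr1.
rewrite inE => /eqP-> /=; exists (fun=> 0); split; first by case.
by rewrite big_ord0.
Qed.

Lemma ideal_expM I k l a b :
  ideal_exp I k a -> ideal_exp I l b -> ideal_exp I (k + l) (a * b).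
Proof.
move=> [s [sI ->]] [t [tI ->]]; rewrite mulr_suml big_seq.
apply: ideal_exp_sum => x /sI[f [fI xE]].
rewrite mulr_sumr big_seq; apply: ideal_exp_sum => y /tI[h [hI yE]].
exists [:: (x.1 * y.1, x.2 * y.2)]; rewrite big_seq1; split; last first.
  by rewrite /= mulrACA.
move=> z; rewrite inE => /eqP-> /=.
exists (fun i => match split i with inl j => f j | inr j => h j end).
split=> [i|]; first by case: split.
rewrite big_split_ord /= xE yE; congr (_ * _); apply: eq_bigr => i _.
- by have /= -> := unsplitK (inl i : 'I_k + 'I_l).
- by have /= -> := unsplitK (inr i : 'I_k + 'I_l).
Qed.

End Ideals.

(* [gr_I(S)], the direct sum of the [I^i / I^(i+1)], is constructed as the
   quotient of the Rees ring [S[It]], i.e. the direct sum of the [I^i t^i]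
   inside [S[t]], by the ideal that is the direct sum of the
   [I^(i+1) t^i]. *)
Section AssociatedGraded.
Variables (S : comNzRingType) (I : set S).

Definition rees_pred : {pred {poly S}} :=
  fun p => `[< forall i, ideal_exp I i p`_i >].

Lemma rees_subring_closed : subring_closed rees_pred.
Proof.
split=> [|p q /asboolP pI /asboolP qI|p q /asboolP pI /asboolP qI];
  apply/asboolP => i.
- rewrite coef1; case: i => [|i] /=; first exact: ideal_exp_unit.
  exact: ideal_exp0.
- by rewrite coefB; apply: ideal_expD => //; apply: ideal_expN.
- rewrite coefM; apply: ideal_exp_sum => j _.
  by rewrite -[X in ideal_exp I X](subnKC (leq_ord j)); apply: ideal_expM.
Qed.

HB.instance Definition _ :=
  GRing.isSubringClosed.Build {poly S} rees_pred rees_subring_closed.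

Record rees := Rees { rees_val : {poly S}; _ : rees_val \in rees_pred }.

HB.instance Definition _ := [isSub for rees_val].
HB.instance Definition _ := [Choice of rees by <:].
HB.instance Definition _ := [SubChoice_isSubComNzRing of rees by <:].

Definition gr_ideal : {pred rees} :=
  fun p => `[< forall i, ideal_exp I i.+1 (rees_val p)`_i >].

Lemma gr_ideal_zmod_closed : zmod_closed gr_ideal.
Proof.
split=> [|p q /asboolP pI /asboolP qI]; apply/asboolP => i.
- by rewrite -[rees_val 0]/(val (0 : rees)) rmorph0 coef0; apply: ideal_exp0.
- rewrite -[rees_val _]/(val (p - q)) rmorphB coefB.
  by apply: ideal_expD; [apply: pI|apply/ideal_expN/qI].
Qed.

HB.instance Definition _ :=
  GRing.isZmodClosed.Build rees gr_ideal gr_ideal_zmod_closed.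

Lemma gr_idealMl p q : q \in gr_ideal -> p * q \in gr_ideal.
Proof.
case: p => p pI /asboolP qI; have /asboolP pI' := pI; apply/asboolP => i.
rewrite -[rees_val _]/(val (Rees pI * q)) rmorphM coefM.
apply: ideal_exp_sum => j _.
rewrite -[X in ideal_exp I X.+1](subnKC (leq_ord j)) -addnS.
exact: ideal_expM.
Qed.

Definition assoc_graded := @Quotient.quot rees gr_ideal.

HB.instance Definition _ := GRing.Zmodule.on assoc_graded.
HB.instance Definition _ := EqQuotient.on assoc_graded.

Definition gr_one : assoc_graded := \pi_assoc_graded 1.
Definition gr_mul := lift_op2 assoc_graded *%R.

Lemma gr_eqE (p q : rees) :
  (\pi_assoc_graded p == \pi_assoc_graded q) = (p - q \in gr_ideal).
Proof. by rewrite Quotient.idealrBE. Qed.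

Lemma gr_pi_add : {morph \pi_assoc_graded : p q / p + q >-> p + q}.
Proof. exact: Quotient.pi_add. Qed.

Lemma gr_pi_mul :
  {morph \pi_assoc_graded : p q / p * q >-> gr_mul p q}.
Proof.
move=> p q; unlock gr_mul; apply/eqP; rewrite gr_eqE.
set p1 := repr (\pi_assoc_graded p); set q1 := repr (\pi_assoc_graded q).
have pI : p - p1 \in gr_ideal by rewrite -gr_eqE reprK.
have qI : q - q1 \in gr_ideal by rewrite -gr_eqE reprK.
have -> : p * q - p1 * q1 = p * (q - q1) + q1 * (p - p1).
  by rewrite !mulrBr [q1 * p]mulrC [q1 * p1]mulrC addrA subrK.
by rewrite rpredD ?gr_idealMl.
Qed.

Lemma gr_mulA : associative gr_mul.
Proof.
by move=> x y z; rewrite -[x]reprK -[y]reprK -[z]reprK -!gr_pi_mul mulrA.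
Qed.

Lemma gr_mulC : commutative gr_mul.
Proof. by move=> x y; rewrite -[x]reprK -[y]reprK -!gr_pi_mul mulrC. Qed.

Lemma gr_mul1 : left_id gr_one gr_mul.
Proof. by move=> x; rewrite -[x]reprK -gr_pi_mul mul1r. Qed.

Lemma gr_mulDl : left_distributive gr_mul +%R.
Proof.
move=> x y z; rewrite -[x]reprK -[y]reprK -[z]reprK.
by rewrite -gr_pi_add -!gr_pi_mul -gr_pi_add mulrDl.
Qed.

HB.instance Definition _ := GRing.Zmodule_isComPzRing.Build assoc_graded
  gr_mulA gr_mulC gr_mul1 gr_mulDl.

End AssociatedGraded.

Definition is_reduced (A : pzRingType) :=
  forall (x : A) k, x ^+ k = 0 -> x = 0.

Section Clutters.
Variable T : finType.
Implicit Types (E : {set {set T}}) (C D : {set T}).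

Definition vertex_cover E C := [forall e in E, ~~ [disjoint e & C]].

Definition minimal_vertex_cover E C := minset (vertex_cover E) C.

Definition unmixed E := forall C D,
  minimal_vertex_cover E C -> minimal_vertex_cover E D -> #|C| = #|D|.

End Clutters.

Section Polyhedra.
Variables (R : realType) (n q : nat).

Definition set_covering_polyhedron (A : 'M[R]_(n, q)) : set 'rV[R]_n :=
  [set x : 'rV[R]_n | (forall i, 0 <= x 0 i) /\ (forall k, 1 <= (x *m A) 0 k)].

(* Vertices are extreme points. *)
Definition is_vertex (Q : set 'rV[R]_n) (x : 'rV[R]_n) :=
  Q x /\ forall y z t, Q y -> Q z -> 0 < t < 1 ->
           x = t *: y + (1 - t) *: z -> y = z.

Definition integral_polyhedron (Q : set 'rV[R]_n) :=
  forall x, is_vertex Q x -> forall i, x 0 i \is a Num.int.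

End Polyhedra.

Section MonomialFamilies.
Variables (n q : nat) (v : 'I_q -> 'X_{1..n}).

Definition exponent_mx (R : realType) : 'M[R]_(n, q) :=
  \matrix_(i < n, k < q) (v k i)%:R.

Definition msupport (m : 'X_{1..n}) : {set 'I_n} := [set i | (0 < m i)%N]%SET.

Definition clutter_edges : {set {set 'I_n}} :=
  [set msupport (v k) | k : 'I_q]%SET.

Definition monomials (K : fieldType) : set {mpoly K[n]} :=
  [set p | exists k, p = 'X_[v k]].

End MonomialFamilies.

Arguments monomials {n q} v K _.

(* The polynomial ring in the variables other than [x_i] is [{mpoly K[n.-1]}],
   embedded in [{mpoly K[n]}] by renaming its [j]-th variable to
   [x_(lift i j)]. *)
Definition omit_var_embed (K : fieldType) (n : nat) (i : 'I_n)
    (p : {mpoly K[n.-1]}) : {mpoly K[n]} :=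
  p \mPo [tuple 'X_(lift i j) | j < n.-1].

Definition omit_var_ideal (K : fieldType) (n : nat) (I : set {mpoly K[n]})
    (i : 'I_n) : set {mpoly K[n.-1]} :=
  omit_var_embed i @^-1` I.

(* Main.v *)
From HB Require Import structures.
Require Import Defs.
From mathcomp Require Import all_boot all_order all_algebra.
From mathcomp Require Import mpoly.
From mathcomp Require Import boolp classical_sets reals.
From mathcomp Require Import ring lra zify.

(** Both implications compare the powers of [I] with other filtrations.

    The ring [gr_I(S)] is reduced exactly when [f^m] in [I^(jm+1)] forces [f] in
    [I^(j+1)] for [f] in [I^j] (assoc_graded_reducedP).  If this holds, an
    element integral over [I^k] can be lifted from [I^j] to [I^(j+1)] as long as
    [j < k], by its integral equation; thus [I] is normal (reduced_normal).
    Setting [x_i = 0] is a retraction of [I] onto [I_i], so [I_i] is normal too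
    (omit_var_normal).

    Conversely, let all the [I_i] be normal.  The point is that a monomial [x^a]
    lies in [I^k] as soon as [a(C) >= k] for every minimal vertex cover [C]
    (cover_bound_power).  Then [I^k] is the intersection over [C] of the [k]-th
    powers of the primes generated by the variables of [C] (ideal_expE).  The
    order along each of these primes is a valuation, which gives the criterion
    above for [gr_I(R)] to be reduced.

    To prove the claim on [x^a], note that the vertices of [Q(A)], being
    integral, dominate indicator vectors of covers, so that [a(C) >= k] for all
    [C] means that the linear form [a] is at least [k] on [Q(A)].  Linear
    programming duality, in the form of Farkas' lemma over the rationals, gives
    a fractional packing of at least [k] edges into [a] (edge_packing), and with
    it an equation of integral dependence of [x^a] over [I^k].  If [a] vanishes
    at some [i], the packing uses only edges that avoid [i]; hence [x^a] is
    integral over a power of [I_i], and normality of [I_i] concludes.  If [a]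
    vanishes nowhere, all minimal covers having the same size [c], it is enough
    to show that [x_1 ... x_n] is in [I^c] and to go on by induction with
    [a - (1, ..., 1)] and [k - c].  An optimal fractional packing of
    [(1, ..., 1)] has total weight [c], so by complementary slackness an edge of
    positive weight meets each minimal cover in one vertex
    (exists_transversal_edge).  Removing this edge from [(1, ..., 1)] creates
    zeros and lowers the value on each minimal cover by exactly one, which is
    the case already settled. *)

Set Implicit Arguments.
Unset Strict Implicit.
Unset Printing Implicit Defensive.

Import Order.TTheory GRing.Theory Num.Theory.
Local Open Scope classical_set_scope.
Local Open Scope ring_scope.

(** * Powers of ideals and integral closure *)

Section IdealPowers.
Variable S : comNzRingType.
Implicit Types (I J : set S) (k l m : nat).

Lemma ideal_gen_in (G : set S) x : G x -> ideal_gen G x.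
Proof.
move=> Gx; exists [:: (1, x)]; split=> [y|]; last by rewrite big_seq1 mul1r.
by rewrite inE => /eqP->.
Qed.

Lemma ideal_gen_subset (G J : set S) :
  is_ideal J -> G `<=` J -> ideal_gen G `<=` J.
Proof.
case=> J0 JD JM GJ _ [s [sG ->]]; rewrite big_seq.
by apply: big_ind => // x /sG /GJ; apply: JM.
Qed.

Lemma ideal_exp_ideal I k : is_ideal (ideal_exp I k).
Proof. exact: ideal_gen_ideal. Qed.

Lemma ideal_exp_prod I k (f : 'I_k -> S) :
  (forall i, I (f i)) -> ideal_exp I k (\prod_(i < k) f i).
Proof. by move=> fI; apply: ideal_gen_in; exists f. Qed.

Lemma ideal_exp_subset I k J : is_ideal J ->
  (forall f : 'I_k -> S, (forall i, I (f i)) -> J (\prod_(i < k) f i)) ->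
  ideal_exp I k `<=` J.
Proof.
by move=> idJ fJ; apply: ideal_gen_subset => // _ [f [fI ->]]; apply: fJ.
Qed.

Lemma ideal_exp_in I x : I x -> ideal_exp I 1 x.
Proof.
by move=> Ix; rewrite -[x](big_ord1 *%R (fun=> x)); apply: ideal_exp_prod.
Qed.

Lemma ideal_exp_add_subset I k l : ideal_exp I (k + l) `<=`
  ideal_gen [set z | exists a b,
               [/\ ideal_exp I k a, ideal_exp I l b & z = a * b]].
Proof.
apply: ideal_exp_subset => [|f fI]; first exact: ideal_gen_ideal.
apply: ideal_gen_in; rewrite big_split_ord /=.
by eexists; eexists; split; last reflexivity; apply: ideal_exp_prod.
Qed.

Lemma ideal_exp_le I k l : (k <= l)%N -> ideal_exp I l `<=` ideal_exp I k.
Proof.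
move=> /subnK<-; rewrite addnC; apply: ideal_exp_subset => [|f fI].
  exact: ideal_exp_ideal.
by rewrite big_split_ord /= mulrC; apply: ideal_expMl; apply: ideal_exp_prod.
Qed.

Lemma ideal_exp_bigprod I (T : Type) (r : seq T) (P : pred T) (e : T -> nat)
    (f : T -> S) :
  (forall i, P i -> ideal_exp I (e i) (f i)) ->
  ideal_exp I (\sum_(i <- r | P i) e i) (\prod_(i <- r | P i) f i).
Proof.
move=> fI; apply: (big_ind2 (fun k x => ideal_exp I k x)) => //.
- exact: ideal_exp_unit.
- by move=> *; apply: ideal_expM.
Qed.

Lemma ideal_expX I k m a : ideal_exp I k a -> ideal_exp I (k * m) (a ^+ m).
Proof.
move=> Ia; have := @ideal_exp_bigprod I _ (index_enum 'I_m) xpredT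
  (fun=> k) (fun=> a) (fun _ _ => Ia).
by rewrite sum_nat_const prodr_const card_ord mulnC.
Qed.

(** A product of [k * m] elements of [I] is a product of [m] blocks of [k]
    factors, whence the inclusion from right to left. *)
Lemma ideal_exp_exp I k m : ideal_exp (ideal_exp I k) m = ideal_exp I (k * m).
Proof.
apply/seteqP; split.
  apply: ideal_exp_subset => [|f fI]; first exact: ideal_exp_ideal.
  have := @ideal_exp_bigprod I _ (index_enum 'I_m) xpredT
    (fun=> k) f (fun i _ => fI i).
  by rewrite sum_nat_const card_ord mulnC.
elim: m => [|m IHm] x; first by move=> _; apply: ideal_exp_unit.
rewrite mulnS => /ideal_exp_add_subset; apply: ideal_gen_subset.
  exact: ideal_exp_ideal.
move=> _ [a [b [Ia Ib ->]]].
by rewrite -add1n; apply: ideal_expM; [apply: ideal_exp_in|apply: IHm].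
Qed.

Lemma integral_closure_subset J : J `<=` integral_closure J.
Proof.
move=> z Jz; exists 1%N, (fun=> - z); split=> // [[|[|i]]//|].
  by move=> _; apply/ideal_expN/ideal_exp_in.
by rewrite big_nat1 subnn expr0 mulr1 expr1 subrr.
Qed.

Lemma integral_closure_pow J m z :
  (0 < m)%N -> ideal_exp J m (z ^+ m) -> integral_closure J z.
Proof.
case: m => // m _ Jz.
exists m.+1, (fun i => if i == m.+1 then - z ^+ m.+1 else 0).
split=> // [i _|].
  by case: eqP => [->|_]; [apply: ideal_expN|apply: ideal_exp0].
rewrite big_nat_recr //= eqxx subnn expr0 mulr1 big_nat big1 ?add0r ?subrr //.
by move=> i /andP[_ /ltn_eqF->]; rewrite mul0r.
Qed.

End IdealPowers.

Section IdealMorphisms.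
Variables (S S' : comNzRingType) (phi : {rmorphism S -> S'}).

Lemma preimage_ideal (J : set S') : is_ideal J -> is_ideal (phi @^-1` J).
Proof.
case=> J0 JD JM; split=> [|a b|a b] /=; rewrite ?rmorph0 ?rmorphD ?rmorphM //.
  exact: JD.
exact: JM.
Qed.

Lemma ideal_exp_rmorph (I : set S) (J : set S') k x :
  I `<=` phi @^-1` J -> ideal_exp I k x -> ideal_exp J k (phi x).
Proof.
move=> IJ; apply: (ideal_exp_subset (preimage_ideal (ideal_exp_ideal J k))).
move=> f fI /=; rewrite rmorph_prod; apply: ideal_exp_prod => i.
exact: IJ.
Qed.

Lemma integral_closure_rmorph (I : set S) (J : set S') x :
  I `<=` phi @^-1` J -> integral_closure I x -> integral_closure J (phi x).
Proof.
move=> IJ [m [a [m0 aI zE]]]; exists m, (phi \o a); split=> // [i /aI|].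
  exact: ideal_exp_rmorph.
rewrite -[RHS](rmorph0 phi) -zE rmorphD rmorphXn rmorph_sum; congr (_ + _).
by apply: eq_bigr => i _; rewrite rmorphM rmorphXn.
Qed.

End IdealMorphisms.

(** * Reducedness of the associated graded ring *)

Section ReducedGraded.
Variables (S : comNzRingType) (I : set S).
Local Open Scope quotient_scope.

Lemma gr_pi_exp (p : rees I) m :
  (\pi_(assoc_graded I) p) ^+ m = \pi_(assoc_graded I) (p ^+ m).
Proof.
elim: m => [|m IHm]; first by rewrite !expr0.
by rewrite !exprS IHm; symmetry; apply: gr_pi_mul.
Qed.

Lemma gr_pi_eq0 (p : rees I) :
  (\pi_(assoc_graded I) p == 0) = (p \in @gr_ideal S I).
Proof.
have -> : 0 = \pi_(assoc_graded I) 0.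
  by apply: (addrI (\pi_(assoc_graded I) 0)); rewrite -gr_pi_add !addr0.
by rewrite gr_eqE subr0.
Qed.

(** It is enough to test homogeneous elements, because the lowest component of
    a nilpotent is nilpotent and can be subtracted. *)
Lemma assoc_graded_reducedP :
  is_reduced (assoc_graded I) <->
  forall f j m, ideal_exp I j f -> ideal_exp I (j * m).+1 (f ^+ m) ->
    ideal_exp I j.+1 f.
Proof.
split=> [red f j m If Ifm|red x m].
  have fP : f%:P * 'X^j \in rees_pred I.
    apply/asboolP => i; rewrite coefCM coefXn.
    by case: eqP => [->|_]; rewrite ?mulr1 ?mulr0 //; apply: ideal_exp0.
  have /red : \pi_(assoc_graded I) (Rees fP) ^+ m = 0.
    apply/eqP; rewrite gr_pi_exp gr_pi_eq0; apply/asboolP => i.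
    rewrite -[rees_val _]/(val (Rees fP ^+ m)) rmorphXn /=.
    rewrite exprMn -rmorphXn -exprM coefCM coefXn.
    by case: eqP => [->|_]; rewrite ?mulr1 ?mulr0 //; apply: ideal_exp0.
  move/eqP; rewrite gr_pi_eq0 => /asboolP /(_ j) /=.
  by rewrite coefCM coefXn eqxx mulr1.
rewrite -[x]reprK gr_pi_exp => /eqP; rewrite gr_pi_eq0.
move: (repr x) => p pm; apply/eqP; rewrite gr_pi_eq0; apply/asboolP.
have pI i : ideal_exp I i (rees_val p)`_i by case: (p) => q /= /asboolP.
move=> i; elim/ltn_ind: i => j IHj.
(* Modulo [gr_ideal] the components of [p] of degree below [j] vanish, so the
   component of degree [j * m] of [p ^+ m] is the power of the lowest one. *)
have tP : take_poly j (rees_val p) \in rees_pred I.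
  apply/asboolP => i; rewrite coef_take_poly.
  by case: ifP => // _; apply: ideal_exp0.
have tG : Rees tP \in @gr_ideal S I.
  apply/asboolP => i /=; rewrite coef_take_poly.
  by case: ifP => [/IHj//|_]; apply: ideal_exp0.
have /asboolP /(_ (j * m)%N) : (p - Rees tP) ^+ m \in @gr_ideal S I.
  rewrite -gr_pi_eq0 -gr_pi_exp.
  have /eqP <- : \pi_(assoc_graded I) p == \pi_(assoc_graded I) (p - Rees tP).
    by rewrite gr_eqE opprD opprK addNKr.
  by rewrite gr_pi_exp gr_pi_eq0.
rewrite -[rees_val _]/(val ((p - Rees tP) ^+ m)) rmorphXn rmorphB /=.
rewrite -{1}(poly_take_drop j (rees_val p)) addrAC subrr add0r exprMn -exprM.
rewrite coefMXn ltnn subnn -horner_coef0 horner_exp horner_coef0.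
by rewrite coef_drop_poly add0n; apply: red.
Qed.

(** If the graded ring is reduced, then [z] integral over [I^k] climbs the
    filtration: from [z] in [I^j] with [j < k], the integral equation puts
    [z^m] in [I^(jm+1)], hence [z] in [I^(j+1)]. *)
Lemma reduced_normal : is_reduced (assoc_graded I) -> is_normal I.
Proof.
move=> /assoc_graded_reducedP red k _; apply/seteqP; split.
  exact: integral_closure_subset.
move=> z [m [a [m0 aI zE]]].
suff climb j : (j <= k)%N -> ideal_exp I j z by apply: climb.
elim: j => [|j IHj] lt_jk; first exact: ideal_exp_unit.
have Iz := IHj (ltnW lt_jk); apply: (red _ _ m) => //.
move/eqP: zE; rewrite addr_eq0 => /eqP ->; apply: ideal_expN.
rewrite big_nat; apply: ideal_exp_sum => i /andP[i1 im].
have /aI : (1 <= i <= m)%N by rewrite i1.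
rewrite ideal_exp_exp => Ia.
apply: ideal_exp_le (ideal_expM Ia (ideal_expX (m - i) Iz)).
by nia.
Qed.

End ReducedGraded.

(** * Linear programming duality *)

Section LinearProgramming.

Lemma mulmx11 (F : fieldType) n (x : 'M[F]_1) (y : 'M[F]_(1, n)) :
  x *m y = x 0 0 *: y.
Proof. by rewrite {1}[x]mx11_scalar mul_scalar_mx. Qed.

Lemma mulmx_ge0 (F : realFieldType) m n p
    (A : 'M[F]_(m, n)) (B : 'M[F]_(n, p)) :
  (forall i j, 0 <= A i j) -> (forall i j, 0 <= B i j) ->
  forall i j, 0 <= (A *m B) i j.
Proof.
by move=> A0 B0 i j; rewrite mxE; apply: sumr_ge0 => k _; apply: mulr_ge0.
Qed.

(** Farkas' lemma, by induction on the number of inequalities (Bartl).  If the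
    first inequality [u] cannot be dropped, some [x0] satisfies the others but
    neither [u] nor [c]; projecting along [x0] onto the hyperplane [u = 0]
    disposes of [u]. *)
Lemma farkas (F : realFieldType) N m (M : 'M[F]_(N, m)) (c : 'cV[F]_N) :
  (forall x : 'rV[F]_N, (forall j, 0 <= (x *m M) 0 j) -> 0 <= (x *m c) 0 0) ->
  exists2 l : 'cV[F]_m, forall j, 0 <= l j 0 & c = M *m l.
Proof.
elim: m M c => [|m IHm] M c Mc.
  exists 0 => [[]//|]; rewrite mulmx0; apply/matrixP => i j; rewrite ord1.
  have c_ge0 : 0 <= ((delta_mx 0 i : 'rV_N) *m c) 0 0 by apply: Mc => -[].
  have c_le0 : 0 <= (- (delta_mx 0 i : 'rV_N) *m c) 0 0 by apply: Mc => -[].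
  move: c_ge0 c_le0; rewrite mulNmx -rowE !mxE oppr_ge0 => c_ge0 c_le0.
  by apply: le_anti; rewrite c_ge0 c_le0.
rewrite -[m.+1]/(1 + m)%N in M Mc *.
rewrite -[M]hsubmxK; set u := lsubmx _; set B := rsubmx _.
have {}Mc (x : 'rV_N) : 0 <= (x *m (u : 'cV_N)) 0 0 ->
    (forall j, 0 <= (x *m B) 0 j) -> 0 <= (x *m c) 0 0.
  move=> xu xB; apply: Mc => j; rewrite -[M]hsubmxK mul_mx_row.
  by case: (@split_ordP 1 m j) => k ->; rewrite ?row_mxEl ?row_mxEr ?ord1.
have [Bc|] := pselect (forall x : 'rV_N, (forall j, 0 <= (x *m B) 0 j) ->
                         0 <= (x *m c) 0 0).
  have [l l0 ->] := IHm _ _ Bc; exists (col_mx 0 l); last first.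
    by rewrite mul_row_col mulmx0 add0r.
  by move=> j; case: (@split_ordP 1 m j) => k ->;
    rewrite ?col_mxEu ?col_mxEd ?mxE ?l0.
move=> /existsNP[x0 /not_implyP[x0B /negP]]; rewrite -ltNge => x0c.
have u0 : (x0 *m u) 0 0 < 0.
  by rewrite ltNge; apply/negP => /Mc /(_ x0B); rewrite leNgt x0c.
set e := (x0 *m u) 0 0 in u0; have e0 : e != 0 by rewrite lt_eqF.
pose B' := B - e^-1 *: (u *m (x0 *m B)).
pose c' := c - ((x0 *m c) 0 0 / e) *: u.
have xB' (x : 'rV_N) : x *m B' = (x - ((x *m u) 0 0 / e) *: x0) *m B.
  rewrite mulmxBr mulmxBl -scalemxAr (mulmxA x) mulmx11 -scalemxAl scalerA.
  by rewrite [_ / e]mulrC.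
have [x xB|l l0 c'E] := IHm B' c'.
  have -> : x *m c' = (x - ((x *m u) 0 0 / e) *: x0) *m c.
    rewrite mulmxBr mulmxBl -scalemxAr -scalemxAl; congr (_ - _).
    apply/matrixP => i j; rewrite !ord1 !mxE; ring.
  apply: Mc => [|j]; last by rewrite -xB'.
  rewrite mulmxBl -scalemxAl mxE [X in _ + X]mxE [X in _ - X]mxE -/e.
  by rewrite divfK // subrr.
pose mu := (x0 *m c) 0 0 / e - e^-1 * (x0 *m B *m l) 0 0.
exists (col_mx mu%:M l); last first.
  rewrite mul_row_col mul_mx_scalar -[c](subrK (((x0 *m c) 0 0 / e) *: u)).
  rewrite -/c' c'E mulmxBl scalerBl -scalemxAl -(mulmxA u).
  have -> : u *m (x0 *m B *m l) = (x0 *m B *m l) 0 0 *: u.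
    by rewrite {1}[x0 *m B *m l]mx11_scalar mul_mx_scalar.
  by rewrite scalerA addrAC [RHS]addrC addrA.
move=> j; case: (@split_ordP 1 m j) => k ->;
  rewrite ?col_mxEu ?col_mxEd ?mxE ?l0 // ord1 eqxx mulr1n.
rewrite subr_ge0; apply: (@le_trans _ _ 0).
  apply: mulr_le0_ge0; first by rewrite invr_le0 ltW.
  by apply: mulmx_ge0 => i j'; rewrite ?ord1.
by apply: mulr_le0; rewrite ?invr_le0 ltW.
Qed.

(** Linear programming duality for a covering problem.  The inequality
    [x *m a >= k] is homogenized to [x *m a - k * t >= 0] with [t >= 0], so that
    Farkas' lemma applies in dimension [n + 1]. *)
Lemma covering_duality (F : realFieldType) n q (A : 'M[F]_(n, q)) (a : 'cV[F]_n)
    (k : F) :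
  (forall i, 0 <= a i 0) ->
  (forall x : 'rV_n, (forall i, 0 <= x 0 i) -> (forall j, 1 <= (x *m A) 0 j) ->
     k <= (x *m a) 0 0) ->
  exists y : 'cV[F]_q, [/\ forall j, 0 <= y j 0,
    forall i, (A *m y) i 0 <= a i 0 & k <= \sum_j y j 0].
Proof.
move=> a0 kP.
(* The columns are the inequalities [x >= 0], [t >= 0] and [x *m A >= t]. *)
pose M : 'M[F]_(n + 1, n + (1 + q)) :=
  block_mx 1%:M (row_mx 0 A) 0 (row_mx 1%:M (const_mx (-1))).
have [x|l l0] := @farkas F _ _ M (col_mx a (- k)%:M).
  rewrite -[x]hsubmxK; move: (lsubmx x) (rsubmx x) => {}x t.
  rewrite mul_row_block mul_row_col mulmx1 mulmx0 addr0 !mul_mx_row mulmx0.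
  rewrite add_row_mx add0r mulmx1 => xM.
  have x0 i : 0 <= x 0 i by have := xM (lshift _ i); rewrite row_mxEl.
  have t0 : 0 <= t 0 0.
    by have := xM (rshift _ (lshift _ 0)); rewrite row_mxEr row_mxEl.
  have xA j : t 0 0 <= (x *m A) 0 j.
    have := xM (rshift _ (rshift _ j)); rewrite !row_mxEr mulmx11 !mxE.
    by rewrite mulrN1 subr_ge0.
  rewrite mulmx11 !mxE eqxx mulr1n mulrN subr_ge0.
  have [t_eq0|t_neq0] := eqVneq (t 0 0) 0.
    by rewrite t_eq0 mul0r; apply: sumr_ge0 => i _; apply: mulr_ge0.
  have t_gt0 : 0 < t 0 0 by rewrite lt_def t_neq0.
  have := kP ((t 0 0)^-1 *: x); rewrite -!scalemxAl => /(_ _ _).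
  rewrite [X in _ -> _ -> _ <= X]mxE ler_pdivlMl // [X in _ -> _ -> _ <= X]mxE.
  apply=> [i|j]; first by rewrite mxE mulr_ge0 ?invr_ge0.
  by rewrite mxE ler_pdivlMl // mulr1.
rewrite -[l]vsubmxK -[dsubmx l]vsubmxK.
set mu := usubmx l; set nu := usubmx _; set y := dsubmx _.
rewrite mul_block_col mul1mx mul0mx add0r !mul_row_col mul0mx add0r mul1mx.
move=> /eq_col_mx[aE kE].
have y0 j : 0 <= y j 0 by rewrite !mxE; apply: l0.
exists y; split=> // [i|].
  have mu0 : 0 <= mu i 0 by rewrite mxE; apply: l0.
  by rewrite aE [X in _ <= X]mxE lerDr.
have nu0 : 0 <= nu 0 0 by rewrite !mxE; apply: l0.
move/matrixP/(_ 0 0): kE; rewrite !mxE eqxx mulr1n => kE.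
have -> : k = \sum_j y j 0 - nu 0 0.
  rewrite -[k]opprK kE opprD addrC; congr (_ + _).
    by rewrite -sumrN; apply: eq_bigr => j _; rewrite mxE mulN1r opprK.
  by rewrite !mxE.
by rewrite lerBlDr lerDl.
Qed.

End LinearProgramming.

(** * Vertices of the set covering polyhedron *)

Section Vertices.
Variables (R : realType) (n q : nat) (A : 'M[R]_(n, q)).
Local Notation Q := (set_covering_polyhedron A).

Let M : 'M[R]_(n, n + q) := row_mx 1%:M A.
Let b : 'rV[R]_(n + q) := row_mx 0 (const_mx 1).

Lemma set_covering_polyhedronE x : Q x <-> forall c, b 0 c <= (x *m M) 0 c.
Proof.
rewrite mul_mx_row mulmx1; split=> [[x0 xA] c|xM].
  by case: (split_ordP c) => j ->; rewrite ?row_mxEl ?row_mxEr mxE.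
split=> j; first by have := xM (lshift _ j); rewrite !row_mxEl mxE.
by have := xM (rshift _ j); rewrite !row_mxEr mxE.
Qed.

(** A linear form with nonnegative coefficients is minimized at vertices: a
    point that is not a vertex can be moved along a segment of the polyhedron,
    without increasing the form, in a direction with a negative coordinate.  The
    positive orthant bounds the motion, and when it stops one more inequality
    is tight. *)
Lemma vertex_le (a : 'cV[R]_n) x : (forall i, 0 <= a i 0) -> Q x ->
  exists2 w, is_vertex Q w & (w *m a) 0 0 <= (x *m a) 0 0.
Proof.
move=> a0.
have [m] := ubnP #|[set c | b 0 c < (x *m M) 0 c]|%SET.
elim: m x => // m IHm x; rewrite ltnS => le_m Qx.
have [xV|] := pselect (is_vertex Q x); first by exists x.
move=> /not_andP[//|/existsNP[y /existsNP[z /existsNP[t]]]].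
move=> /not_implyP[Qy /not_implyP[Qz /not_implyP[/andP[t0 t1]]]].
move=> /not_implyP[xE /eqP neq_yz].
(* Both [y] and [z] are tight wherever [x] is; [d] is [y - z] or [z - y]. *)
have [d [dT [i di] da]] : exists d : 'rV[R]_n,
    [/\ forall c, (x *m M) 0 c = b 0 c -> (d *m M) 0 c = 0,
        exists i, d 0 i < 0 & (d *m a) 0 0 <= 0].
  have yzT c : (x *m M) 0 c = b 0 c -> ((y - z) *m M) 0 c = 0.
    have /set_covering_polyhedronE/(_ c) yc := Qy.
    have /set_covering_polyhedronE/(_ c) zc := Qz.
    rewrite xE mulmxDl mulmxBl -!scalemxAl; move: yc zc; rewrite !mxE.
    move: (\sum_j _) (\sum_j _) (b 0 c) => u u' e; nra.
  have dneg (d : 'rV[R]_n) : (d *m a) 0 0 < 0 -> exists i, d 0 i < 0.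
    apply: contraPP => /forallNP d0; apply/negP; rewrite -leNgt.
    apply: mulmx_ge0 => i j; rewrite ?ord1 //.
    by rewrite leNgt; apply/negP/d0.
  have [lt_da|lt_ad|eq_da] := ltgtP (((y - z) *m a) 0 0) 0.
  - by exists (y - z); split; [|apply: dneg|apply: ltW].
  - exists (z - y); rewrite -opprB.
    have lt_ad' : (- (y - z) *m a) 0 0 < 0 by rewrite mulNmx mxE oppr_lt0.
    split; [|exact: dneg|exact: ltW].
    by move=> c /yzT yz0; rewrite mulNmx mxE yz0 oppr0.
  have [i yzi] : exists i, (y - z) 0 i != 0.
    apply/not_existsP => yz0; case/eqP: neq_yz; apply/matrixP => j i.
    by rewrite ord1; apply/eqP; rewrite -subr_eq0; have /negP := yz0 i;
       rewrite negbK !mxE.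
  have [lt_yz|lt_zy|/eqP] := ltgtP ((y - z) 0 i) 0; last by rewrite (negPf yzi).
    by exists (y - z); split=> //; [exists i|rewrite eq_da].
  exists (z - y); rewrite -opprB; split.
  - by move=> c /yzT yz0; rewrite mulNmx mxE yz0 oppr0.
  - by exists i; rewrite mxE oppr_lt0.
  - by rewrite mulNmx mxE eq_da oppr0.
have Mi : (d *m M) 0 (lshift q i) < 0 by rewrite mul_mx_row mulmx1 row_mxEl.
(* [ratio c] is the time at which the motion [x + s *: d] makes [c] tight. *)
pose ratio c := ((x *m M) 0 c - b 0 c) / - (d *m M) 0 c.
case: (@arg_minP _ _ _ (lshift q i) (fun c => (d *m M) 0 c < 0) ratio Mi).
move=> c0 dc0 c0min; set s := ratio c0 in c0min.
have xb c : 0 <= (x *m M) 0 c - b 0 c.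
  by rewrite subr_ge0; move/set_covering_polyhedronE: Qx; apply.
have s0 : 0 <= s by rewrite divr_ge0 // oppr_ge0 ltW.
have xdM c : ((x + s *: d) *m M) 0 c = (x *m M) 0 c + s * (d *m M) 0 c.
  by rewrite mulmxDl -scalemxAl mxE [X in _ + X]mxE.
have [||w wV wa] := IHm (x + s *: d).
- apply: leq_trans le_m; apply/proper_card/properP; split.
    apply/fintype.subsetP => c; rewrite !inE xdM.
    apply: contraTT; rewrite -!leNgt => xc.
    have {}xc : (x *m M) 0 c = b 0 c.
      by apply: le_anti; rewrite xc -subr_ge0 xb.
    by rewrite dT // mulr0 addr0 xc.
  exists c0; rewrite !inE.
    rewrite lt_def -subr_ge0 xb andbT; apply: contraTneq dc0 => xc.
    by rewrite dT ?ltxx.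
  rewrite xdM /s /ratio invrN mulrN mulNr divfK ?lt_eqF //.
  by rewrite opprB addrC subrK ltxx.
- apply/set_covering_polyhedronE => c; rewrite xdM -subr_ge0 addrAC.
  have [dc|dc] := ltP ((d *m M) 0 c) 0; last first.
    by rewrite addr_ge0 ?xb //; apply: mulr_ge0.
  have := c0min c dc; rewrite /ratio ler_pdivlMr ?oppr_gt0 // mulrN.
  by rewrite -subr_ge0 opprK.
exists w => //; apply: le_trans wa _.
rewrite mulmxDl -scalemxAl mxE [X in _ + X]mxE gerDl.
exact: mulr_ge0_le0.
Qed.

End Vertices.

(** * Packings of edges of a clutter *)

Section Packing.
Variables (n q : nat) (v : 'I_q -> 'X_{1..n}).
Local Notation E := (clutter_edges v).
Implicit Types (C : {set 'I_n}) (a : 'I_n -> nat).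

Definition bounded_below_on_covers a k :=
  forall C, minimal_vertex_cover E C -> (k <= \sum_(i in C) a i)%N.

Lemma vertex_cover_edge C j :
  vertex_cover E C -> exists2 i, i \in C & (0 < v j i)%N.
Proof.
move=> /forall_inP /(_ (msupport (v j)) (imset_f _ isT)).
rewrite disjoint_subset => /subsetPn[i]; rewrite !inE negbK => vi iC.
by exists i.
Qed.

Lemma vertex_cover_sum C j : vertex_cover E C -> (0 < \sum_(i in C) v j i)%N.
Proof.
move=> /(@vertex_cover_edge _ j)[i iC vi].
by rewrite (bigD1 i) //= addn_gt0 vi.
Qed.

Lemma clear_denominators (T : finType) (y : T -> rat) : (forall t, 0 <= y t) ->
  exists N (c : T -> nat), (0 < N)%N /\ forall t, (c t)%:R = N%:R * y t.
Proof.
move=> y0; pose N := (\prod_t `|denq (y t)|)%N.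
exists N, (fun t => `|numq (y t)| * \prod_(s | s != t) `|denq (y s)|)%N; split.
  by apply/prodn_gt0 => t; rewrite absz_gt0 denq_neq0.
move=> t; rewrite /N [X in _ = X%:R * _](bigD1 t) //= !natrM.
rewrite -[X in _ = _ * X]divq_num_den.
have -> : (`|numq (y t)|%N)%:R = (numq (y t))%:~R :> rat.
  by rewrite natr_absz ger0_norm ?numq_ge0.
have -> : (`|denq (y t)|%N)%:R = (denq (y t))%:~R :> rat.
  by rewrite natr_absz ger0_norm ?denq_ge0.
have d0 : (denq (y t))%:~R != 0 :> rat by rewrite intr_eq0 denq_neq0.
by field.
Qed.

Variable R : realType.
Local Notation Q := (set_covering_polyhedron (exponent_mx v R)).
Hypothesis Q_int : integral_polyhedron Q.

(** An integral vertex dominates the indicator vector of its support, and this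
    support is a vertex cover. *)
Lemma cover_bound_polyhedron a k x : bounded_below_on_covers a k -> Q x ->
  k%:R <= \sum_i x 0 i * (a i)%:R.
Proof.
move=> ak Qx.
have a0 i : 0 <= (\col_i (a i)%:R : 'cV[R]_n) i 0 by rewrite mxE.
have [w wV] := vertex_le a0 Qx.
have dotE (y : 'rV[R]_n) :
    (y *m (\col_i (a i)%:R)) 0 0 = \sum_i y 0 i * (a i)%:R.
  by rewrite mxE; apply: eq_bigr => i _; rewrite mxE.
rewrite !dotE; apply: le_trans.
have [[w0 wA] _] := wV.
have w_ge1 i : 0 < w 0 i -> 1 <= w 0 i.
  have /intrP[z ->] := Q_int wV i.
  by rewrite ltr0z ler1z.
pose C : {set 'I_n} := [set i | 0 < w 0 i]%SET.
have Ccov : vertex_cover E C.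
  apply/forall_inP => _ /imsetP[j _ ->]; apply/pred0Pn.
  apply/existsP; apply: contraTT (wA j); rewrite -ltNge => /existsPn Cj.
  rewrite mxE big1 ?ltr01 // => i _; rewrite !mxE.
  have := Cj i; rewrite !inE negb_and -!leNgt -eqn0Ngt => /orP[|] .
    by move=> /eqP->; rewrite mulr0.
  move=> wi; have -> : w 0 i = 0 by apply: le_anti; rewrite wi w0.
  by rewrite mul0r.
have [D Dmin DC] := minset_exists Ccov.
apply: (@le_trans _ _ (\sum_(i in D) (a i)%:R)).
  by rewrite -natr_sum ler_nat; apply: ak.
rewrite [leRHS](bigID (mem D)) /= -[leLHS]addr0; apply: lerD.
  apply: ler_sum => i /(fintype.subsetP DC); rewrite inE => /w_ge1 wi.
  by rewrite ler_peMl.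
by apply: sumr_ge0 => i _; rewrite mulr_ge0.
Qed.

(** By duality the weighted covering bound is attained by a fractional packing
    of edges; [N] is a common denominator of it. *)
Lemma edge_packing a k : bounded_below_on_covers a k ->
  exists N (c : 'I_q -> nat), [/\ (0 < N)%N,
    forall i, (\sum_j c j * v j i <= N * a i)%N & (N * k <= \sum_j c j)%N].
Proof.
move=> ak.
have [i|x x0 xA|y [y0 Ay ky]] :=
  @covering_duality rat n q (\matrix_(i, j) (v j i)%:R) (\col_i (a i)%:R) k%:R.
- by rewrite mxE.
- rewrite -(ler_rat R) ratr_nat.
  have -> : ratr ((x *m (\col_i (a i)%:R)) 0 0) =
            \sum_i (map_mx ratr x) 0 i * (a i)%:R :> R.
    rewrite mxE rmorph_sum; apply: eq_bigr => i _.
    by rewrite !mxE rmorphM /= ratr_nat.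
  apply: cover_bound_polyhedron ak _; split=> [i|j]; first by rewrite mxE ler0q.
  have := xA j; rewrite -(ler_rat R) rmorph1 => /le_trans; apply.
  rewrite !mxE rmorph_sum le_eqVlt; apply/orP; left; apply/eqP/eq_bigr => i _.
  by rewrite !mxE rmorphM /= ratr_nat.
have [N [c [N0 cE]]] := clear_denominators (fun j => y0 j).
exists N, c; split=> // [i|].
  rewrite -(ler_nat rat) natr_sum natrM; have := Ay i.
  rewrite !mxE => /(ler_wpM2l (ler0n _ N)); apply: le_trans.
  rewrite mulr_sumr le_eqVlt; apply/orP; left; apply/eqP/eq_bigr => j _.
  by rewrite natrM cE mxE mulrAC mulrA.
rewrite -(ler_nat rat) natr_sum natrM.
rewrite (eq_bigr _ (fun j _ => cE j)) -mulr_sumr.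
by rewrite ler_pM2l ?ltr0n.
Qed.

(** Complementary slackness: an edge of positive weight in an optimal packing of
    the all-one vector meets each minimal cover once, because all of these
    covers are optimal when the clutter is unmixed. *)
Lemma exists_transversal_edge g : (0 < g)%N ->
  (forall C, minimal_vertex_cover E C -> #|C| = g) ->
  exists j, forall C, minimal_vertex_cover E C -> (\sum_(i in C) v j i = 1)%N.
Proof.
move=> g0 Cg.
have [|N [c [N0 cv cg]]] := @edge_packing (fun=> 1%N) g.
  by move=> C /Cg<-; rewrite sum1_card.
have [j cj] : exists j, (0 < c j)%N.
  apply/existsP; apply: contraTT cg => /existsPn c0.
  rewrite big1 => [|j _]; first by rewrite leqn0 muln_eq0 negb_or -!lt0n N0.
  by apply/eqP; rewrite -leqn0 leqNgt; apply: c0.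
exists j => C Cmin; apply: anti_leq; rewrite leqNgt.
have Ccov : vertex_cover E C by have /minsetP[] := Cmin.
rewrite vertex_cover_sum // andbT; apply/negP => vj.
have : (\sum_j c j * \sum_(i in C) v j i <= N * g)%N.
  rewrite -(Cg C Cmin) -sum1_card big_distrr /=.
  under eq_bigr do rewrite big_distrr /=.
  by rewrite exchange_big /=; apply: leq_sum => i _;
     rewrite muln1 -[N in leqRHS]muln1.
move/leq_trans/(_ cg); rewrite leqNgt => /negP; apply.
rewrite (bigD1 j) //= [X in (_ < X)%N](bigD1 j) //= -addSn.
apply: leq_add; first by rewrite -[X in (X < _)%N]muln1 ltn_pmul2l.
by apply: leq_sum => l _; rewrite leq_pmulr // vertex_cover_sum.
Qed.

End Packing.

(** * Omitting a variable *)

Section OmittedVariable.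
Variables (K : fieldType) (n : nat) (i : 'I_n).

HB.instance Definition _ := GRing.RMorphism.copy (@omit_var_embed K n i)
  (comp_mpoly [tuple 'X_(lift i j) | j < n.-1]).

Definition restrict_mnm (m : 'X_{1..n}) : 'X_{1..n.-1} :=
  [multinom m (lift i j) | j < n.-1].

Lemma omit_var_embedX (m : 'X_{1..n}) :
  m i = 0%N -> omit_var_embed i 'X_[restrict_mnm m] = 'X_[m] :> {mpoly K[n]}.
Proof.
move=> mi; rewrite /omit_var_embed comp_mpolyX (mpolyXE_id _ m).
rewrite (bigD1_ord i) //= mi expr0 mul1r.
by apply: eq_bigr => j _; rewrite tnth_mktuple mnmE.
Qed.

Definition kill_var (p : {mpoly K[n]}) : {mpoly K[n.-1]} :=
  p \mPo [tuple oapp (fun j => 'X_j) 0 (unlift i k) | k < n].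

HB.instance Definition _ := GRing.RMorphism.copy kill_var
  (comp_mpoly [tuple oapp (fun j => 'X_j) 0 (unlift i k) | k < n]).

Lemma kill_varX_eq0 (m : 'X_{1..n}) : (0 < m i)%N -> kill_var 'X_[m] = 0.
Proof.
move=> mi; rewrite /kill_var comp_mpolyX (bigD1_ord i) //=.
by rewrite tnth_mktuple unlift_none /= expr0n gtn_eqF // mul0r.
Qed.

Lemma kill_var_embed p : kill_var (omit_var_embed i p) = p.
Proof.
rewrite /omit_var_embed comp_mpolyE /kill_var raddf_sum /= [RHS]mpolyE.
apply: eq_bigr => m _; rewrite comp_mpolyZ; congr (_ *: _).
rewrite rmorph_prod (mpolyXE_id _ m); apply: eq_bigr => j _.
by rewrite rmorphXn /= !tnth_mktuple comp_mpolyXU -tnth_nth tnth_mktuple liftK.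
Qed.

End OmittedVariable.

Section MonomialIdeals.
Variables (K : fieldType) (n q : nat) (v : 'I_q -> 'X_{1..n}).
Local Notation I := (ideal_gen (monomials v K)).
Local Notation E := (clutter_edges v).

Lemma monomial_in k : I 'X_[v k].
Proof. by apply: ideal_gen_in; exists k. Qed.

Lemma kill_var_ideal i p : I p -> omit_var_ideal I i (kill_var i p).
Proof.
have idI : is_ideal I := ideal_gen_ideal _.
apply: (@ideal_gen_subset _ _ (kill_var i @^-1` omit_var_ideal I i)).
  exact/preimage_ideal/preimage_ideal.
move=> _ [k ->] /=; have [vki|vki] := posnP (v k i).
  rewrite -(omit_var_embedX _ vki) kill_var_embed /omit_var_ideal /=.
  by rewrite omit_var_embedX //; apply: monomial_in.
by rewrite kill_varX_eq0 // /omit_var_ideal /= rmorph0; have [] := idI.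
Qed.

(** Normality passes from [I] to [I_i] because [I_i] is a retract of [I]:
    setting [x_i = 0] maps [I ^ k] into [I_i ^ k]. *)
Lemma omit_var_normal i : is_normal I -> is_normal (omit_var_ideal I i).
Proof.
move=> nI k k1; apply/seteqP; split; first exact: integral_closure_subset.
move=> z zI; rewrite -[z](kill_var_embed i).
apply: ideal_exp_rmorph (@kill_var_ideal i) _.
rewrite (nI k k1); apply: integral_closure_rmorph zI.
by move=> x; apply: ideal_exp_rmorph.
Qed.

End MonomialIdeals.

Section PackedMonomials.
Variables (K : fieldType) (n q : nat) (J : set {mpoly K[n]}).

(** A packing with denominator [N] writes [x^(N a)] as a multiple of a product of
    [N k] elements of [J], which is an equation of integral dependence of
    [x^a] over [J^k]. *)
Lemma packing_integral (w : 'I_q -> 'X_{1..n}) (c : 'I_q -> nat)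
    (a : 'X_{1..n}) N k :
  (0 < N)%N -> (forall j, (0 < c j)%N -> J 'X_[w j]) ->
  (forall i, (\sum_j c j * w j i <= N * a i)%N) -> (N * k <= \sum_j c j)%N ->
  integral_closure (ideal_exp J k) 'X_[a].
Proof.
move=> N0 Jw wa kc; apply: (@integral_closure_pow _ _ N) => //.
rewrite ideal_exp_exp mpolyXn mulnC; apply: ideal_exp_le kc _ _.
pose s : 'X_{1..n} := (\sum_j w j *+ c j)%MM.
have le_s : (s <= a *+ N)%MM.
  apply/mnm_lepP => i; rewrite mnm_sumE mulmnE mulnC.
  by under eq_bigr do rewrite mulmnE mulnC; apply: wa.
rewrite -(submK le_s) mpolyXD; apply: ideal_expMl.
rewrite -mprodXnE; apply: ideal_exp_bigprod => j _.
have [->|cj] := posnP (c j); first by rewrite expr0; apply: ideal_exp_unit.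
by rewrite -[X in ideal_exp _ X]mul1n; apply/ideal_expX/ideal_exp_in/Jw.
Qed.

End PackedMonomials.

(** * The order of a polynomial along a vertex cover *)

Section CoverDegree.
Variables (K : fieldType) (n : nat) (C : {set 'I_n}).

(** [x_i] is sent to [x_i T] when [i] lies in [C], so that the monomial [x^m]
    becomes [x^m T^(m(C))].  The powers of the prime ideal of [C] are the
    preimages of those of [T], which makes the order along [C] a valuation. *)
Definition cover_grading : {mpoly K[n]} -> {poly {mpoly K[n]}} :=
  mmap (polyC \o @mpolyC n K) (fun i => ('X_i)%:P * 'X^(i \in C)).

HB.instance Definition _ := GRing.RMorphism.copy cover_grading
  (mmap (polyC \o @mpolyC n K) (fun i => ('X_i)%:P * 'X^(i \in C))).

Definition cover_power k : set {mpoly K[n]} :=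
  [set f | exists p, cover_grading f = p * 'X^k].

Lemma cover_gradingX (m : 'X_{1..n}) :
  cover_grading 'X_[m] = 'X_[m]%:P * 'X^(\sum_(i in C) m i).
Proof.
rewrite /cover_grading mmapX /mmap1.
transitivity (\prod_i (('X_i ^+ m i)%:P * 'X^((i \in C) * m i)%N)
  : {poly {mpoly K[n]}}).
  by apply: eq_bigr => i _; rewrite exprMn -exprM polyC_exp.
rewrite big_split /= -rmorph_prod -mpolyXE_id; congr (_ * _).
rewrite [in RHS]big_mkcond -prodrXr; apply: eq_bigr => i _.
by case: (i \in C); rewrite ?mul1n ?mul0n.
Qed.

Lemma cover_grading_coef f j m :
  ((cover_grading f)`_j)@_m = f@_m *+ (\sum_(i in C) m i == j)%N.
Proof.
have -> : cover_grading f =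
    \sum_(u <- msupp f) (f@_u *: 'X_[u])%:P * 'X^(\sum_(i in C) u i).
  rewrite {1}[f]mpolyE rmorph_sum; apply: eq_bigr => u _.
  rewrite -mul_mpolyC rmorphM /= cover_gradingX /cover_grading mmapC /=.
  by rewrite polyCM mulrA.
rewrite coef_sum raddf_sum /=.
under eq_bigr do rewrite coefCM coefXn.
have [mf|mf] := boolP (m \in msupp f); last first.
  rewrite memN_msupp_eq0 // mul0rn big_seq big1 // => u uf.
  rewrite mulr_natr raddfMn /= mcoeffZ mcoeffX.
  by case: eqP uf mf => [-> ->|_ _ _]//; rewrite mulr0 mul0rn.
rewrite (bigD1_seq m) ?msupp_uniq //= [X in _ + X]big1 ?addr0 => [|u um].
  by rewrite mulr_natr raddfMn /= mcoeffZ mcoeffX eqxx mulr1 eq_sym.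
by rewrite mulr_natr raddfMn /= mcoeffZ mcoeffX (negPf um) mulr0 mul0rn.
Qed.

Lemma cover_power_ideal k : is_ideal (cover_power k).
Proof.
split=> [|f g [p fE] [p' gE]|f g [p gE]].
- by exists 0; rewrite rmorph0 mul0r.
- by exists (p + p'); rewrite rmorphD /= fE gE mulrDl.
- by exists (cover_grading f * p); rewrite rmorphM /= gE mulrA.
Qed.

Lemma cover_power_msupp k f m :
  cover_power k f -> m \in msupp f -> (k <= \sum_(i in C) m i)%N.
Proof.
move=> [p fE]; rewrite mcoeff_msupp; apply: contraNleq => lt_mk.
have := cover_grading_coef f (\sum_(i in C) m i)%N m.
by rewrite eqxx fE coefMXn lt_mk mcoeff0 => /esym/eqP.
Qed.

(** If [f] had order exactly [j], then [f^m] would have order exactly [j * m],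
    since [{poly {mpoly K[n]}}] is a domain. *)
Lemma cover_power_reduced j m f : cover_power j f ->
  cover_power (j * m).+1 (f ^+ m) -> cover_power j.+1 f.
Proof.
move=> [p fE] [r]; rewrite rmorphXn /= fE exprMn -exprM exprS mulrA.
have X0 : 'X^(j * m) != 0 :> {poly {mpoly K[n]}}.
  by rewrite expf_neq0 ?polyX_eq0.
move=> /(mulIf X0) /(congr1 (fun s : {poly {mpoly K[n]}} => s`_0)).
rewrite coefMX /= -horner_coef0 horner_exp horner_coef0 => /eqP.
rewrite expf_eq0 => /andP[_ /eqP p0].
have : root p 0 by apply/rootP; rewrite horner_coef0.
move=> /factor_theorem[p' pE]; exists p'.
by rewrite fE pE subr0 exprS mulrA.
Qed.

End CoverDegree.

(** * Powers of the ideal and vertex covers *)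

Section CoverPowers.
Variables (R : realType) (K : fieldType) (n q : nat) (v : 'I_q -> 'X_{1..n}).
Local Notation I := (ideal_gen (monomials v K)).
Local Notation E := (clutter_edges v).

Lemma ideal_exp_cover_power C k :
  vertex_cover E C -> ideal_exp I k `<=` @cover_power K n C k.
Proof.
move=> Ccov; apply: ideal_exp_subset => [|f fI]; first exact: cover_power_ideal.
have /choice[p pE] : forall i, cover_power C 1 (f i).
  move=> i; apply: ideal_gen_subset (fI i); first exact: cover_power_ideal.
  move=> _ [j ->]; exists ('X_[v j]%:P * 'X^((\sum_(i in C) v j i).-1)%N).
  by rewrite cover_gradingX -mulrA -exprD addn1 prednK // vertex_cover_sum.
exists (\prod_i p i); rewrite rmorph_prod /=.
by rewrite (eq_bigr _ (fun i _ => pE i)) big_split /= prodr_const card_ord.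
Qed.

Hypothesis Q_int :
  integral_polyhedron (set_covering_polyhedron (exponent_mx v R)).
Hypothesis v_sqfree : forall k i, (v k i <= 1)%N.
Hypothesis v_neq0 : forall k, exists i, (0 < v k i)%N.
Hypothesis I_unmixed : unmixed E.
Hypothesis I_normal : forall i, is_normal (omit_var_ideal I i).

(** A fractional packing only uses edges that avoid the zeros of [a], hence can
    be turned into an integral equation over [I_i] when [a i = 0]. *)
Lemma cover_bound_omit k (a : 'X_{1..n}) i : (0 < k)%N -> a i = 0%N ->
  bounded_below_on_covers v a k -> ideal_exp I k 'X_[a].
Proof.
move=> k0 ai0 /(edge_packing Q_int)[N [c [N0 ca ck]]].
rewrite -(omit_var_embedX _ ai0).
apply: (@ideal_exp_rmorph _ _ (omit_var_embed i) (omit_var_ideal I i)) => //.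
rewrite (I_normal i k0).
apply: (packing_integral N0 _ _ ck (w := fun j => restrict_mnm i (v j))).
  move=> j cj; have vji0 : v j i = 0%N.
    have := ca i; rewrite ai0 muln0 leqn0 sum_nat_eq0 => /forallP /(_ j).
    by rewrite muln_eq0 eqn0Ngt cj => /eqP.
  by rewrite /omit_var_ideal /= omit_var_embedX //; apply: monomial_in.
by move=> t; rewrite mnmE; under eq_bigr do rewrite mnmE; apply: ca.
Qed.

Let ones : 'X_{1..n} := [multinom 1%N | i < n].

(** The vertex set splits into [g] edges: split off an edge meeting all minimal
    covers once; the rest satisfies the covering bound with [g - 1] and has a
    zero, so that the previous lemma applies. *)
Lemma ones_in_power g : (0 < g)%N ->
  (forall C, minimal_vertex_cover E C -> #|C| = g) -> ideal_exp I g 'X_[ones].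
Proof.
move=> g0 Cg; have [j vj] := exists_transversal_edge Q_int g0 Cg.
have [i vji] := v_neq0 j.
have le1 : (v j <= ones)%MM by apply/mnm_lepP => t; rewrite mnmE.
rewrite -(submK le1) mpolyXD -(prednK g0) -addn1.
apply: ideal_expM; last exact/ideal_exp_in/monomial_in.
have [->|g1] := posnP g.-1; first exact: ideal_exp_unit.
apply: (cover_bound_omit (i := i)) => //.
  by rewrite mnmBE mnmE; apply/eqP; rewrite subn_eq0.
move=> C Cmin; under eq_bigr do rewrite mnmBE mnmE.
by rewrite sumnB // vj // sum1_card Cg // subn1.
Qed.

Lemma cover_bound_power k (a : 'X_{1..n}) :
  bounded_below_on_covers v a k -> ideal_exp I k 'X_[a].
Proof.
elim/ltn_ind: k a => k IHk a ak.
have [->|k0] := posnP k; first exact: ideal_exp_unit.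
have [/existsP[i /eqP ai0]|/existsPn a0] := boolP [exists i, a i == 0%N].
  exact: (cover_bound_omit k0 ai0 ak).
have Tcov : vertex_cover E [set: 'I_n]%SET.
  apply/forall_inP => _ /imsetP[j _ ->]; have [i vji] := v_neq0 j.
  by apply/pred0Pn; exists i; rewrite /= !inE vji.
have [C Cmin _] := minset_exists Tcov.
have Cg D : minimal_vertex_cover E D -> #|D| = #|C|.
  by move=> Dmin; apply: I_unmixed.
have g0 : (0 < #|C|)%N.
  rewrite lt0n; apply: contraTneq (ak C Cmin) => /eqP.
  by rewrite cards_eq0 => /eqP->; rewrite big_set0 -ltnNge.
have le1 : (ones <= a)%MM by apply/mnm_lepP => t; rewrite mnmE lt0n.
rewrite -(submK le1) mpolyXD.
apply: (@ideal_exp_le _ _ k (k - #|C| + #|C|)); first lia.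
apply: ideal_expM; last exact: ones_in_power.
apply: IHk => [|D Dmin]; first lia.
under eq_bigr do rewrite mnmBE mnmE.
rewrite sumnB => [|t _]; last by rewrite lt0n.
by rewrite sum1_card Cg // leq_sub2r // ak.
Qed.

Lemma ideal_expE k f : ideal_exp I k f <->
  forall C, minimal_vertex_cover E C -> cover_power C k f.
Proof.
split=> [If C /minsetP[Ccov _]|fC]; first exact: ideal_exp_cover_power If.
rewrite [f]mpolyE big_seq; apply: ideal_exp_sum => m mf.
rewrite -mul_mpolyC; apply: ideal_expMl; apply: cover_bound_power => C Cmin.
exact: cover_power_msupp (fC C Cmin) mf.
Qed.

Lemma omit_var_normal_reduced : is_reduced (assoc_graded I).
Proof.
apply/assoc_graded_reducedP => f j m /ideal_expE fj /ideal_expE fm.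
apply/ideal_expE => C Cmin.
exact: cover_power_reduced (fj C Cmin) (fm C Cmin).
Qed.

End CoverPowers.

Theorem theorem5p10 (R : realType) (K : fieldType) (n q d g : nat)
    (v : 'I_q -> 'X_{1..n}) (I : set {mpoly K[n]})
    (v_inj : injective v)
    (I_gen : minimally_generates (monomials v K) I)
    (v_sqfree : forall k i, (v k i <= 1)%N)
    (v_deg : forall k, mdeg (v k) = d)
    (d_ge2 : (2 <= d)%N)
    (v_cover : forall i, exists k, (0 < v k i)%N)
    (I_height : has_height I g)
    (g_ge2 : (2 <= g)%N)
    (I_unmixed : unmixed (clutter_edges v))
    (Q_int : integral_polyhedron (set_covering_polyhedron (exponent_mx v R))) :
  is_reduced (assoc_graded I) <-> forall i : 'I_n, is_normal (omit_var_ideal I i).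
Proof.
have [-> _] := I_gen; split=> [red i|nI].
  exact/omit_var_normal/reduced_normal.
apply: (omit_var_normal_reduced Q_int) => // k.
have /existsP : [exists i, (0 < v k i)%N]; last by [].
rewrite -[X in is_true X]negbK negb_exists; apply/negP => /forallP vk0.
have := v_deg k; rewrite mdegE big1 => [d0|i _]; first by rewrite -d0 in d_ge2.
by apply/eqP; rewrite -leqn0 leqNgt; apply: vk0.
Qed.
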